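(* A position $(a,b)$ has Sprague-Grundy value $2$ in $\mathcal{F}$-Wythoff if and only if it is an element of the set $$\{(0,2),(1,3)\}\cup\{(\lfloor \phi n \rfloor+4,\ \lfloor \phi^2 n \rfloor +4) \mid n \in \mathbb{Z},\ n\geq 0 \}.$$
   Context: $\phi = (1+\sqrt5)/2$ and $\lfloor\cdot\rfloor$ is the integer part. A position is an unordered pair $(a,b)$ of nonnegative integers (two piles of tokens); $(a,b)$ is identified with $(b,a)$. $\mathcal{F}$-Wythoff is the impartial game with the following legal moves: (i) remove any positive number of tokens from one pile; (ii) remove the same positive number $k$ of tokens from both piles, provided the integer ratio of the two entries does not change, i.e. from $(a,b)$ with $1\le a\le b$ one may move to $(a-k,b-k)$ with $1\le k<a$ if $\lfloor (b-k)/(a-k)\rfloor=\lfloor b/a\rfloor$. The followers of $p$ are the positions reachable from $p$ by one legal move. For a finite set $S$ of nonnegative integers, $\mathrm{mex}(S)$ is the smallest nonnegative integer not in $S$ (so $\mathrm{mex}\,\emptyset=0$). The Sprague-Grundy value is defined inductively by $\mathcal{G}(p)=\mathrm{mex}\{\mathcal{G}(q)\mid q \text{ is a follower of } p\}$. *)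

(* Defs.v *)
From mathcomp Require Import all_boot all_order all_algebra.
From mathcomp Require Import zify.
From mathcomp Require Import boolp classical_sets reals.

Set Implicit Arguments.
Unset Strict Implicit.
Unset Printing Implicit Defensive.

Import Order.TTheory GRing.Theory Num.Theory.

Definition position := {p : nat * nat | p.1 <= p.2}.

Fact pos_subproof a b : (minn a b, maxn a b).1 <= (minn a b, maxn a b).2.
Proof. exact: leq_trans (geq_minl a b) (leq_maxl a b). Qed.

(* The unordered pair with entries [a] and [b], given in either order. *)
Definition pos (a b : nat) : position :=
  exist _ (minn a b, maxn a b) (pos_subproof a b).

Lemma posC a b : pos a b = pos b a.
Proof. by apply: val_inj; rewrite /= minnC maxnC. Qed.

Lemma posK (p : position) : pos (val p).1 (val p).2 = p.
Proof.
apply: val_inj => /=; case: p => [[a b] /= le_ab].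
by rewrite (minn_idPl le_ab) (maxn_idPr le_ab).
Qed.

Lemma val_pos a b : a <= b -> val (pos a b) = (a, b).
Proof. by move=> le_ab /=; rewrite (minn_idPl le_ab) (maxn_idPr le_ab). Qed.

(* [follower p q]: one legal move leads from [p] to [q].  Since [pos a b] is
   [pos b a], [move_one] covers the removal of tokens from either pile. *)
Inductive follower : position -> position -> Prop :=
| move_one a b k : 1 <= k <= a -> follower (pos a b) (pos (a - k) b)
| move_both a b k : 1 <= a <= b -> 1 <= k < a ->
    (b - k) %/ (a - k) = b %/ a ->
    follower (pos a b) (pos (a - k) (b - k)).

Definition followers (p : position) : seq position :=
  let: (a, b) := val p in
  [seq pos (a - k) b | k <- iota 1 a] ++
  [seq pos a (b - k) | k <- iota 1 b] ++
  [seq pos (a - k) (b - k) | k <- iota 1 a.-1 & (b - k) %/ (a - k) == b %/ a].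

Lemma followersP p q : reflect (follower p q) (q \in followers p).
Proof.
apply: (iffP idP).
  rewrite -{2}[p]posK /followers; case: p => [[a b] /= le_ab].
  rewrite !mem_cat => /or3P[] /mapP[k].
  - by rewrite mem_iota => hk ->; apply: move_one; lia.
  - rewrite mem_iota => hk ->; rewrite posC [pos a _]posC.
    by apply: move_one; lia.
  - rewrite mem_filter mem_iota => /andP[/eqP eq_ratio hk] ->.
    by apply: move_both => //; lia.
case=> a b k.
  move=> hk; rewrite /followers; case: (leqP a b) => [le_ab | /ltnW le_ba].
    rewrite val_pos // mem_cat; apply/orP; left; apply/mapP; exists k => //.
    by rewrite mem_iota; lia.
  rewrite [pos a b]posC val_pos // !mem_cat; apply/or3P; apply: Or32.
  apply/mapP; exists k; last by rewrite posC.
  by rewrite mem_iota; lia.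
move=> /andP[a_gt0 le_ab] hk eq_ratio; rewrite /followers val_pos // !mem_cat.
apply/or3P; apply: Or33; apply/mapP; exists k => //.
by rewrite mem_filter eq_ratio eqxx mem_iota; lia.
Qed.

Lemma ex_notin (s : seq nat) : exists n, n \notin s.
Proof.
exists (\max_(i <- s) i).+1; apply/negP => s_max.
by have := @leq_bigmax_seq _ s xpredT id _ s_max isT; rewrite ltnn.
Qed.

Definition mex (s : seq nat) : nat := ex_minn (ex_notin s).

Lemma eq_mex s t : s =i t -> mex s = mex t.
Proof.
move=> eq_st; rewrite /mex; case: ex_minnP => m sm min_m.
case: ex_minnP => n tn min_n.
by apply/eqP; rewrite eqn_leq min_m ?eq_st // min_n // -eq_st.
Qed.

Definition tokens (p : position) : nat := (val p).1 + (val p).2.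

Lemma tokens_pos a b : tokens (pos a b) = a + b.
Proof. by rewrite /tokens /= addn_min_max. Qed.

Lemma follower_tokens p q : follower p q -> tokens q < tokens p.
Proof. by case=> a b k; rewrite !tokens_pos; lia. Qed.

(* The recursion of the Sprague-Grundy function, cut off at depth [n]; every
   move decreases the number of tokens, so depth [tokens p] + 1 suffices for
   [p], and [grundyE] is the intended defining equation. *)
Fixpoint grundy_rec (n : nat) (p : position) : nat :=
  if n is n'.+1 then mex (map (grundy_rec n') (followers p)) else 0.

Definition grundy (p : position) : nat := grundy_rec (tokens p).+1 p.

Lemma grundy_rec_stable m n p :
  tokens p < m -> tokens p < n -> grundy_rec m p = grundy_rec n p.
Proof.
elim: m n p => [|m IHm] [|n] p //= lt_pm lt_pn; congr mex.
apply/eq_in_map => q /followersP /follower_tokens lt_qp.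
by apply: IHm; lia.
Qed.

Lemma grundyE p : grundy p = mex (map grundy (followers p)).
Proof.
rewrite {1}/grundy /=; congr mex.
apply/eq_in_map => q /followersP /follower_tokens lt_qp.
exact: grundy_rec_stable.
Qed.

Local Open Scope ring_scope.

Definition phi (R : realType) : R := (1 + Num.sqrt 5) / 2.

(* Main.v *)
Require Import Defs.
From mathcomp Require Import all_boot all_order all_algebra.
From mathcomp Require Import zify lra.
From mathcomp Require Import boolp classical_sets reals.

Import Order.TTheory GRing.Theory Num.Theory.
Local Open Scope classical_set_scope.
Local Open Scope ring_scope.

Set Implicit Arguments.
Unset Strict Implicit.
Unset Printing Implicit Defensive.

(* For [i < 3] the positions of value [i] are a copy of Wythoff's P-positions
   [(A_n, A_n + n)] shifted by [2 ^ i], together with [(0, i)] and, if [i = 2],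
   also [(1, 3)].  By Beatty's theorem every number occurs exactly once as an
   entry of such a set [L_i] (up to the double entry of [(2 ^ i, 2 ^ i)] and of
   [(0, 0)]), which settles the moves in one pile.  As [n <= A_n], all shifted
   Wythoff pairs have integer ratio [1], and the differences [n] are distinct;
   so no move in both piles stays in [L_i], and a pair lying between
   [(x, x)] and [(x, B_n + 2 ^ i)], with [x = A_n + 2 ^ i], reaches the element
   of [L_i] with the same difference without leaving ratio [1].  Hence [L_i]
   is stable, and absorbs every position outside [L_0] up to [L_i]. *)

(** * Sprague-Grundy values from a family of levels *)

Lemma mem_lt_mex (s : seq nat) i : (i < mex s)%N -> i \in s.
Proof.
rewrite /mex; case: ex_minnP => m _ min_m lt_im.
by apply/negPn/negP => /min_m; lia.
Qed.

Lemma mex_notin (s : seq nat) : mex s \notin s.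
Proof. by rewrite /mex; case: ex_minnP. Qed.

Lemma grundy_neq_follower p q : follower p q -> grundy p <> grundy q.
Proof.
move=> /followersP pq eq_g; have := mex_notin (map grundy (followers p)).
by rewrite -grundyE eq_g map_f.
Qed.

Lemma grundy_gt_follower p i :
  (i < grundy p)%N -> exists2 q, follower p q & grundy q = i.
Proof.
rewrite grundyE => /mem_lt_mex /mapP[q /followersP pq ->].
by exists q.
Qed.

(** Induction on the number of tokens. If [p] in [L i] had a smaller value [g], disjointness and
    absorption would give it a follower in [L g], again of value [g]; a larger value would give a
    follower of value [i], hence in [L i], against stability. Conversely, a position of value [i]
    lies in no [L j] with [j < i], so outside [L i] absorption would give it a follower of value
    [i]. *)
Lemma grundy_levels (m : nat) (L : nat -> set position) :
  (forall i j p, (i < j < m)%N -> L i p -> ~ L j p) ->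
  (forall i p q, (i < m)%N -> L i p -> follower p q -> ~ L i q) ->
  (forall i p, (i < m)%N -> (forall j, (j <= i)%N -> ~ L j p) ->
     exists2 q, follower p q & L i q) ->
  forall i p, (i < m)%N -> grundy p = i <-> L i p.
Proof.
move=> disj stable absorb i p lt_im.
have [t le_pt] := ex_intro (fun t => tokens p < t)%N _ (ltnSn (tokens p)).
elim: t p le_pt i lt_im => // t IHt p lt_pt.
have IH i q : (i < m)%N -> follower p q -> grundy q = i <-> L i q.
  by move=> lt_im /follower_tokens lt_qp; apply: IHt => //; lia.
have level_grundy i : (i < m)%N -> L i p -> grundy p = i.
  move=> lt_im Lip; case: (ltngtP (grundy p) i) => // [lt_gi|lt_ig].
    have [||q pq eq_g] := absorb (grundy p) p; first by lia.
      by move=> j le_j Ljp; apply: (disj j i p) => //; lia.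
    by case: (grundy_neq_follower pq); apply/esym/IH => //; lia.
  have [q pq /(IH _ _ lt_im pq)] := grundy_gt_follower lt_ig.
  by move/(stable _ _ _ lt_im Lip pq).
move=> i lt_im; split=> [eq_g|]; last exact: level_grundy.
apply: contrapT => nLip.
have [j le_ji Ljp|q pq /(IH _ _ lt_im pq) eq_gq] := absorb i p lt_im.
  have [eq_ij|neq_ij] := eqVneq i j; first by apply: nLip; rewrite eq_ij.
  by have := level_grundy j _ Ljp; lia.
by apply: (grundy_neq_follower pq); rewrite eq_g eq_gq.
Qed.

(** * The golden ratio and the two Wythoff sequences *)

Lemma phi_sqr (R : realType) : phi R ^+ 2 = phi R + 1.
Proof.
rewrite /phi; have := @sqr_sqrtr R 5 (ler0n _ _).
by move: (Num.sqrt _) => s; nra.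
Qed.

Lemma phi_gt1 (R : realType) : 1 < phi R.
Proof.
have : Num.sqrt 1 < Num.sqrt 5 :> R by rewrite ltr_sqrt; lra.
by rewrite sqrtr1 /phi; lra.
Qed.

(* Infinite descent through [(k, n) |-> (n, k - n)]. *)
Lemma golden_descent (n k : nat) : (k * k = n * k + n * n)%N -> n = 0%N.
Proof.
elim/ltn_ind: n k => n IHn k eq_k.
case: (posnP n) => // n_gt0.
have lt_nk : (n <= k)%N by nia.
have lt_k2n : (k - n < n)%N by nia.
have : (k - n = 0)%N by apply: (IHn _ lt_k2n n); nia.
by nia.
Qed.

Lemma phi_irrational (R : realType) (n k : nat) :
  phi R * n%:R = k%:R -> n = 0%N.
Proof.
move=> eq_k; apply: (@golden_descent n k); apply/eqP.
rewrite -(eqr_nat R) !(natrD, natrM) -eq_k; apply/eqP.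
by have := phi_sqr R; rewrite expr2; nra.
Qed.

(** The lower Wythoff sequence [A_n]. As [phi ^ 2 = phi + 1], the upper one is written
    [wythoff R n + n] throughout. *)
Definition wythoff (R : realType) (n : nat) : nat := Num.truncn (phi R * n%:R).

Lemma wythoff_itv (R : realType) n :
  (wythoff R n)%:R <= phi R * n%:R < (wythoff R n)%:R + 1.
Proof.
rewrite natr1; apply: truncn_itv; apply: mulr_ge0 => //.
by have := phi_gt1 R; lra.
Qed.

Lemma wythoff_eq (R : realType) (n k : nat) :
  k%:R <= phi R * n%:R < k%:R + 1 -> wythoff R n = k.
Proof. by rewrite natr1; exact: truncn_def. Qed.

Lemma truncn_phi_sqr (R : realType) n :
  Num.truncn (phi R ^+ 2 * n%:R) = (wythoff R n + n)%N.
Proof.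
apply: truncn_def; rewrite -natr1 natrD phi_sqr.
by have := wythoff_itv R n; lra.
Qed.

Lemma wythoff0 (R : realType) : wythoff R 0 = 0%N.
Proof. by apply: wythoff_eq; lra. Qed.

Lemma wythoff_ltS (R : realType) n : (wythoff R n < wythoff R n.+1)%N.
Proof.
rewrite -ltnS -(ltr_nat R) -!natr1.
have := wythoff_itv R n; have := wythoff_itv R n.+1; rewrite -natr1.
by have := phi_gt1 R; lra.
Qed.

Lemma wythoff_lt (R : realType) :
  {homo wythoff R : m n / (m < n)%N >-> (m < n)%N}.
Proof. by apply: homo_ltn ltn_trans _; exact: wythoff_ltS. Qed.

Lemma leq_wythoff (R : realType) n : (n <= wythoff R n)%N.
Proof. by elim: n => // n IHn; have := wythoff_ltS R n; lia. Qed.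

(* As [1 / phi + 1 / phi ^ 2 = 1], a common value [k] satisfies
   [k <= n + m < k + 1], and then [n = k / phi]. *)
Lemma wythoff_disjoint (R : realType) m n :
  wythoff R n = (wythoff R m + m)%N -> n = 0%N /\ m = 0%N.
Proof.
move=> eq_nm; suff n0 : n = 0%N by move: eq_nm; rewrite n0 wythoff0; lia.
apply: (@phi_irrational R _ (wythoff R n)).
have := wythoff_itv R n; have := wythoff_itv R m.
have := phi_gt1 R; have := phi_sqr R; rewrite expr2.
set k := wythoff R n in eq_nm *.
have -> : (wythoff R m)%:R = k%:R - m%:R :> R by rewrite eq_nm natrD; lra.
move: (phi R) => f f2 f1 /andP[m1 m2] /andP[n1 n2].
(* Multiplication by [f - 1] is division by [f]; this form keeps the inequalities within reach of
   [lra]. *)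
have f3 (x : R) : f * (f - 1) * x = x.
  by rewrite (_ : f * (f - 1) = 1) ?mul1r //; lra.
have g0 : 0 < f - 1 by lra.
have lo (x y : R) : y <= f * x -> y * (f - 1) <= x.
  by rewrite -(ler_pM2r g0); have := f3 x; lra.
have hi (x y : R) : f * x < y -> x < y * (f - 1).
  by rewrite -(ltr_pM2r g0); have := f3 x; lra.
have n3 := lo _ _ n1; have n4 := hi _ _ n2.
(* [2 - f] is [1 / f ^ 2], so the bounds on [m] take two divisions by [f]. *)
have m3 : k%:R * (2 - f) <= m%:R.
  have := lo m%:R (k%:R * (f - 1)); have := lo _ _ m1.
  by have := f3 k%:R; lra.
have m4 : m%:R < (k%:R + 1) * (2 - f).
  have := hi m%:R ((k%:R + 1) * (f - 1)); have := hi _ _ m2.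
  by have := f3 (k%:R + 1); lra.
have le_k : (k <= n + m)%N by rewrite -(ler_nat R) natrD; lra.
have ge_k : (n + m <= k)%N by rewrite -ltnS -(ltr_nat R) -natr1 natrD; lra.
have eq_k : k%:R = n%:R + m%:R :> R by rewrite -natrD; congr _%:R; lia.
have -> : n%:R = k%:R * (f - 1) :> R by lra.
by have := f3 k%:R; lra.
Qed.

(** If [k] lies strictly between the lower terms of indices [n] and [n + 1], then [phi * n < k] and
    [k + 1 < phi * (n + 1)]. Multiplying by [phi] gives [n < phi * (k - n) < n + 1], so [k] is the
    upper term of index [k - n]. *)
Lemma wythoff_cover (R : realType) k :
  exists n, k = wythoff R n \/ k = (wythoff R n + n)%N.
Proof.
have [n le_kn min_n] :=
  ex_minnP (ex_intro (fun n => k <= wythoff R n)%N k (leq_wythoff R k)).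
have [eq_kn|neq_kn] := eqVneq k (wythoff R n); first by exists n; left.
case: n le_kn min_n neq_kn => [|n] le_kn min_n neq_kn.
  by move: le_kn neq_kn; rewrite wythoff0; lia.
have lt_nk : (wythoff R n < k)%N by rewrite ltnNge; apply/negP => /min_n; lia.
have lt_kn : (k < wythoff R n.+1)%N by lia.
have le_nk : (n <= k)%N by have := leq_wythoff R n; lia.
exists (k - n)%N; right; suff -> : wythoff R (k - n) = n by lia.
have := wythoff_itv R n.+1; have := wythoff_itv R n.
(* Irrationality makes [k + 1 <= phi * (n + 1)] strict, as the upper bound of the truncation
   requires. *)
have neq : phi R * n.+1%:R != k.+1%:R by apply/eqP => /phi_irrational.
have := phi_gt1 R; have := phi_sqr R; rewrite expr2.
have {}lt_nk : (wythoff R n)%:R + 1 <= k%:R :> R by rewrite natr1 ler_nat.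
have {}lt_kn : k%:R + 1 <= (wythoff R n.+1)%:R :> R by rewrite natr1 ler_nat.
rewrite -!natr1 in neq *; move=> f2 f1 /andP[_ n2] /andP[n3 _].
have lt1 : phi R * n%:R < k%:R by lra.
have lt2 : k%:R + 1 < phi R * (n%:R + 1).
  by rewrite lt_neqAle eq_sym neq /=; lra.
apply: wythoff_eq; rewrite natrB //.
move: (phi R) f2 f1 lt1 lt2 => f f2 f1 lt1 lt2.
have f_gt0 : 0 < f by lra.
have f3 (x : R) : f * (f * x) = f * x + x by rewrite mulrA f2 mulrDl mul1r.
rewrite -(ltr_pM2l f_gt0) f3 in lt1; rewrite -(ltr_pM2l f_gt0) f3 in lt2.
by lra.
Qed.

(** Strict monotonicity as a disjunction that [lia] can split on. *)
Lemma wythoff_cmp (R : realType) m n :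
  (m < n /\ wythoff R m < wythoff R n \/
   m = n /\ wythoff R m = wythoff R n \/
   n < m /\ wythoff R n < wythoff R m)%N.
Proof.
case: (ltngtP m n) => [lt_mn|lt_nm|->]; last by right; left.
  by left; split => //; apply: wythoff_lt.
by right; right; split => //; apply: wythoff_lt.
Qed.

(** * The levels: disjointness, stability and absorption *)

Definition ordered_level (R : realType) (i a b : nat) : Prop :=
  (a = 0 /\ b = i \/ i = 2 /\ a = 1 /\ b = 3 \/
   exists n, a = wythoff R n + 2 ^ i /\ b = wythoff R n + n + 2 ^ i)%N.

Definition level (R : realType) (i : nat) : set position :=
  [set p | ordered_level R i (val p).1 (val p).2].

Lemma ordered_level_leq (R : realType) i a b :
  ordered_level R i a b -> (a <= b)%N.
Proof. by case=> [an|[an|[n an]]]; lia. Qed.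

Lemma level_pos (R : realType) i a b : (a <= b)%N ->
  level R i (pos a b) <-> ordered_level R i a b.
Proof. by move=> le_ab; rewrite /level /mkset val_pos. Qed.

Lemma level_posP (R : realType) i a b :
  level R i (pos a b) <-> ordered_level R i a b \/ ordered_level R i b a.
Proof.
wlog le_ab : a b / (a <= b)%N => [IH|].
  have [/IH //|/ltnW/IH] := leqP a b; rewrite posC => ->; tauto.
rewrite level_pos //; split=> [|[] //]; first by left.
move=> ba; have le_ba := ordered_level_leq ba.
have eq_ab : a = b by lia.
by rewrite eq_ab in ba *.
Qed.

Lemma expn2_lt3 i : (i < 3)%N ->
  (i = 0 /\ 2 ^ i = 1 \/ i = 1 /\ 2 ^ i = 2 \/ i = 2 /\ 2 ^ i = 4)%N.
Proof. by case: i => [|[|[|]]] // _; tauto. Qed.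

(** Both Wythoff sequences are injective and they meet only at index 0; the sporadic entries lie
    below the shift. This excludes moves in one pile within a level. *)
Lemma level_fun (R : realType) i a a' b : (i < 3)%N ->
  level R i (pos a b) -> level R i (pos a' b) -> a = a'.
Proof.
move=> /expn2_lt3; rewrite !level_posP /ordered_level; move: (2 ^ i)%N => c i3.
case=> [[an|[an|[n an]]]|[an|[an|[n an]]]];
  case=> [[am|[am|[m am]]]|[am|[am|[m am]]]]; try lia;
  have := wythoff_cmp R m n; have := @wythoff_disjoint R m n;
  have := @wythoff_disjoint R n m; lia.
Qed.

Lemma level_disjoint (R : realType) i j p : (i < j < 3)%N ->
  level R i p -> ~ level R j p.
Proof.
rewrite -[p]posK; case: p => -[a b] /= le_ab lt_ij3.
have /expn2_lt3 : (i < 3)%N by lia.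
have /expn2_lt3 : (j < 3)%N by lia.
rewrite !level_pos // /ordered_level.
move: (2 ^ i)%N (2 ^ j)%N => c d j3 i3.
case=> [an|[an|[n an]]]; case=> [am|[am|[m am]]]; try lia.
  (* Here [(1, 3)] would be a shifted Wythoff pair of index 2, forcing [wythoff R 2 = 0]. *)
  by have := leq_wythoff R n; lia.
by have := wythoff_cmp R m n; lia.
Qed.

Lemma divn_eq1 a b : (a <= b < a + a)%N -> (b %/ a = 1)%N.
Proof.
move=> b_itv; rewrite -(subnK (n := b) (m := a)); last by lia.
by rewrite divnDr ?divnn ?divn_small //; lia.
Qed.

Lemma level_stable (R : realType) i p q : (i < 3)%N ->
  level R i p -> follower p q -> ~ level R i q.
Proof.
move=> lt_i3 + pq; case: pq => a b k.
  by move=> k_itv lp /(level_fun lt_i3 lp); lia.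
move=> /andP[a_gt0 le_ab] k_itv; rewrite !level_pos; try lia.
rewrite /ordered_level; have := expn2_lt3 lt_i3; move: (2 ^ i)%N => c i3.
(* The ratio condition excludes the move from a shifted pair, of ratio 1, to [(1, 3)], of ratio 3.
   Between two shifted pairs, the preserved difference forces [m = n]. *)
move=> eq_ratio; case=> [an|[an|[n an]]]; case=> [am|[am|[m am]]]; try lia.
by have := wythoff_cmp R m n; lia.
Qed.

Lemma level_absorb (R : realType) i p : (i < 3)%N ->
  (forall j, (j <= i)%N -> ~ level R j p) ->
  exists2 q, follower p q & level R i q.
Proof.
move=> lt_i3; rewrite -[p]posK; case: p => -[a b] /= le_ab notL.
have single_move a' b' : (a' < a /\ b' = b \/ a' = a /\ b' < b)%N ->
    ordered_level R i a' b' \/ ordered_level R i b' a' ->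
    exists2 q, follower (pos a b) q & level R i q.
  move=> lt_ab' lev; exists (pos a' b'); last exact/level_posP.
  case: lt_ab' => -[].
    move=> lt_a' ->; have -> : a' = (a - (a - a'))%N by lia.
    by apply: move_one; lia.
  move=> -> lt_b'; have -> : b' = (b - (b - b'))%N by lia.
  by rewrite posC [pos a _]posC; apply: move_one; lia.
have not_ordered j : (j <= i)%N -> ~ ordered_level R j a b.
  by move=> le_ji; rewrite -level_pos //; apply: notL.
have not_zero j : (j <= i)%N -> ~ (a = 0%N /\ b = j).
  by move=> /not_ordered + ?; apply; left.
have not11 : ~ (a = 1 /\ b = 1)%N.
  move=> ab1; apply: (not_ordered 0%N) => //; right; right; exists 0%N.
  by rewrite wythoff0.
have not13 : i = 2%N -> ~ (a = 1 /\ b = 3)%N.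
  by move=> i2 ab13; apply: (not_ordered i) => //; right; left.
have := expn2_lt3 lt_i3; move def_c : (2 ^ i)%N => c i3.
have wythoff_level n :
    ordered_level R i (wythoff R n + c) (wythoff R n + n + c).
  by right; right; exists n; rewrite def_c.
have sporadic_level : ordered_level R i 0 i by left.
(* An entry below the shift occurs only in a sporadic element, which is reached by a move in one
   pile. *)
have [lt_ac|ge_ac] := ltnP a c.
  have [a0|a_neq0] := eqVneq a 0%N.
    apply: (single_move 0%N i); last by left.
    by have := not_zero 0%N; have := not_zero 1%N; have := not_zero 2%N; lia.
  case: i3 => [|[[i1 c2]|[i2 c4]]]; first by lia.
    apply: (single_move 1%N 0%N); first by lia.
    by right; rewrite -[X in ordered_level _ _ _ X]i1.
  have level13 : ordered_level R i 1 3 by right; left.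
  have level02 : ordered_level R i 0 2 by left.
  have [a1|a_neq1] := eqVneq a 1%N.
    have [b2|b_neq2] := eqVneq b 2%N.
      by apply: (single_move 0%N 2%N); [lia | left].
    by apply: (single_move 1%N 3%N); [lia | left].
  have [a2|a_neq2] := eqVneq a 2%N.
    by apply: (single_move 2%N 0%N); [lia | right].
  by apply: (single_move 3%N 1%N); [lia | right].
(* With [0 < n], the lower partner [wythoff R n + c] is below [a], hence below [b], so the larger
   pile can be reduced to it. *)
have [n [eq_a|[n_gt0 eq_a]]] : exists n, (a = wythoff R n + c \/
    0 < n /\ a = wythoff R n + n + c)%N.
  have [n eq_n] := wythoff_cover R (a - c)%N.
  by exists n; lia.
- have [lt_b|gt_b|eq_b] := ltngtP b (wythoff R n + n + c)%N.
  (* Here [d < n], so the pair of index [d] has smaller entries and the same difference as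
     [(a, b)]. *)
  + set d := (b - a)%N; have cmp := wythoff_cmp R d n.
    exists (pos (wythoff R d + c) (wythoff R d + d + c)); last first.
      by apply/level_posP; left.
    have -> : (wythoff R d + d + c = b - (wythoff R n - wythoff R d))%N by lia.
    have -> : (wythoff R d + c = a - (wythoff R n - wythoff R d))%N by lia.
    apply: move_both; try lia.
    have le_n := leq_wythoff R n; have le_d := leq_wythoff R d.
    by rewrite !divn_eq1 //; lia.
  + apply: (single_move a (wythoff R n + n + c)%N); first by lia.
    by left; rewrite eq_a.
  + by case: (not_ordered i) => //; rewrite eq_a eq_b.
- apply: (single_move a (wythoff R n + c)%N); first by lia.
  by right; rewrite eq_a.
Qed.

Lemma grundy_level (R : realType) i p :
  (i < 3)%N -> grundy p = i <-> level R i p.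
Proof.
apply: grundy_levels i p; [exact: level_disjoint | exact: level_stable |].
exact: level_absorb.
Qed.

(* [Num.truncn] is the nat-valued floor on nonnegative reals. *)
Theorem theorem8 (R : realType) (a b : nat) :
  grundy (pos a b) = 2%N <->
  ([set pos 0 2; pos 1 3] `|`
   [set pos (Num.truncn (phi R * n%:R) + 4)
            (Num.truncn (phi R ^+ 2 * n%:R) + 4) | n in [set: nat]])
    (pos a b).
Proof.
rewrite (grundy_level R) //; move: (pos a b) => p.
have pos_val x y :
    (x <= y)%N -> p = pos x y <-> (val p).1 = x /\ (val p).2 = y.
  move=> le_xy; split=> [->|[<- <-]]; last by rewrite posK.
  by rewrite val_pos.
split=> [[|[[_]|[n]]]|[[|]|[n _]]].
- by move/pos_val => -> //; left; left.
- by move/pos_val => -> //; left; right.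
- move/pos_val => ->; last by rewrite -addnA leq_add2l leq_addl.
  by right; exists n => //; rewrite truncn_phi_sqr.
- by move/pos_val => [] // ? ?; left.
- by move/pos_val => [] // ? ?; right; left.
- rewrite truncn_phi_sqr -/(wythoff R n) => /esym/pos_val[|? ?]; first by lia.
  by right; right; exists n.
Qed.
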